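(* For every prime $p<200000$, $\mathscr{A}(p)=\mathscr{B}(p)$.
   Context: Let $p$ be a prime. For an integer $r\ge 2$ let $x_1,\ldots,x_r$ be independent indeterminates over $\mathbb{F}_p$ and $f(x)=(x-x_1)\cdots(x-x_r)\in\mathbb{F}_p[x_1,\ldots,x_r][x]$. For integers $e\ge 0$ and $0\le d\le p$ write $f(x)^e=\sum_{i\ge0}c_ix^i$ (with $c_i=0$ for $i<0$) and let $M_d(f(x)^e)$ be the $d\times d$ matrix whose $(i,j)$ entry is $c_{ip+j-d-1}$. Put $\delta(x_1,\ldots,x_r)=\prod_{1\le i<j\le r}(x_i-x_j)$. $\mathscr{A}(p)$ is the set of integer triples $(r,e,d)$ with $r\ge2$, $e\ge1$, $1\le d\le p$, such that $\det M_d(f(x)^e)=\varepsilon\,\delta(x_1,\ldots,x_r)^g$ for some $\varepsilon\in\mathbb{F}_p^{\times}$ and some positive integer $g$. $\mathscr{B}(p)=\mathscr{B}_+(p)\cup\mathscr{B}_0(p)\cup\mathscr{B}_-(p)$ where $\mathscr{B}_+(p)=\{(r,e,d): 2\le r\le p,\ e=p-1,\ d=r\}$, $\mathscr{B}_0(p)=\{(r,e,d): 2\le r\le p+1,\ (p-1)/2<e\le p-1,\ r(p-1-e)\le p-1,\ d=r-1\}$, $\mathscr{B}_-(p)=\{(r,e,d): r\ge2,\ (p-1)/2<e\le p-1,\ r(p-1-e)=p-1,\ d=r-2\}$ (integer triples). *)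

(* Defs.v *)
From HB Require Import structures.
From mathcomp Require Import all_boot all_algebra.
From mathcomp Require Import mpoly.

Set Implicit Arguments.
Unset Strict Implicit.
Unset Printing Implicit Defensive.

Import GRing.Theory.
Local Open Scope ring_scope.

Definition fpoly (p r : nat) : {poly {mpoly 'F_p[r]}} :=
  \prod_(i < r) ('X - ('X_i)%:P).

(* M_d(f^e): the d x d matrix whose (i,j) entry (1-based) is
   c_{ip + j - d - 1}.  With 0-based indices i', j' this index is
   (i'+1) p + j' - d, which is >= 0 since d <= p; when d > p (not used)
   the truncated subtraction is irrelevant to the statement. *)
Definition Mmat (p r e d : nat) : 'M[{mpoly 'F_p[r]}]_d :=
  \matrix_(i < d, j < d) ((fpoly p r) ^+ e)`_(i.+1 * p + j - d)%N.

Definition delta (p r : nat) : {mpoly 'F_p[r]} :=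
  \prod_(i < r) \prod_(j < r | (i < j)%N) ('X_i - 'X_j).

Definition inA (p r e d : nat) : Prop :=
  [/\ (2 <= r)%N, (1 <= e)%N, (1 <= d <= p)%N &
    exists eps : 'F_p, exists g : nat,
      [/\ eps != 0, (0 < g)%N &
          \det (Mmat p r e d) = eps%:MP * (delta p r) ^+ g]].

(* B_+(p), B_0(p), B_-(p); the condition (p-1)/2 < e is written
   p - 1 < 2 e (all quantities are natural numbers here). *)
Definition inBplus (p r e d : nat) : bool :=
  [&& 2 <= r <= p, e == p - 1 & d == r]%N.

Definition inB0 (p r e d : nat) : bool :=
  [&& 2 <= r <= p.+1, p - 1 < 2 * e, e <= p - 1,
      r * (p - 1 - e) <= p - 1 & d == r - 1]%N.

Definition inBminus (p r e d : nat) : bool :=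
  [&& 2 <= r, p - 1 < 2 * e, e <= p - 1,
      r * (p - 1 - e) == p - 1 & d == r - 2]%N.

Definition inB (p r e d : nat) : bool :=
  [|| inBplus p r e d, inB0 p r e d | inBminus p r e d].

(* Main.v *)
From HB Require Import structures.
Require Import Defs.
From mathcomp Require Import all_boot all_algebra all_fingroup.
From mathcomp Require Import mpoly.
From mathcomp Require Import zify ring.

Set Implicit Arguments.
Unset Strict Implicit.
Unset Printing Implicit Defensive.

Import GRing.Theory.
Local Open Scope ring_scope.

(** Put [q = p - 1] and [k = q - e].

    Necessity.  Specialise [x_j] to [t ^ w_j] with [w] strictly increasing.  For
    [e < p] the degree in [t] of the coefficient [c_n] is attained by a single
    monomial, which uses the roots of largest weight first; as a function of [n]
    it is concave, strictly so across any interval longer than [e].  Hence the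
    antidiagonal of the matrix, whose indices are [n = i q], gives the unique
    term of highest degree of the determinant.  Comparing with [delta ^ g] for
    two choices of [w] yields
    [\sum_(i <= d) max (m e - i q) 0 = g * 'C(m, 2)] for all [m <= r], which
    forces [(r, e, d)] to lie in the list.  When [p <= e], the first row
    vanishes at [x_1 = 0] while [delta] does not.

    Sufficiency.  The row vector [(1, a ^ p, a ^ (2 p), ...)] with [a = x_i] maps
    the matrix to a row divisible by [(x_i - x_j) ^ (2 e - q)]: it evaluates at
    [a ^ p] the Cartier operator [\sum_n h_n x ^ n |-> \sum_i h_(ip-1) x ^ (i-1)],
    which kills [(x - a) ^ p * K] there.  So [delta ^ (2 e - q)] divides the
    determinant; both have the same degree, and the determinant is nonzero by
    the computation above. *)

(** * Degrees of the coefficients under a monomial specialisation *)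

Lemma ltn_sum_nat (m n : nat) (E F : nat -> nat) : (m < n)%N ->
  (forall i, (m <= i < n)%N -> (E i < F i)%N) ->
  (\sum_(m <= i < n) E i < \sum_(m <= i < n) F i)%N.
Proof.
move=> lt_mn ltEF; rewrite !(big_ltn lt_mn) -addSn leq_add ?ltEF ?leqnn //.
rewrite big_nat_cond [leqRHS]big_nat_cond; apply: leq_sum => i.
by rewrite andbT => /andP[lt_mi lt_in]; rewrite ltnW // ltEF // lt_in ltnW.
Qed.

(* The degree of the coefficient of [x ^ n] in
   [\prod_(j < r) (x - t ^ w j) ^ e]: the [r * e - n] factors contributing a root
   are chosen among those of largest weight. *)
Definition greedy_deg (w : nat -> nat) (e r n : nat) : nat :=
  (\sum_(n <= m < r * e) w (m %/ e))%N.

Lemma greedy_degSl w e r n : (n <= r * e)%N ->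
  greedy_deg w e r.+1 n = (greedy_deg w e r n + w r * e)%N.
Proof.
move=> le_n; rewrite /greedy_deg (@big_cat_nat _ _ _ (r * e)%N) //=; last first.
  by rewrite leq_mul2r leqnSn orbT.
congr addn; rewrite [LHS](@eq_big_nat _ _ _ _ _ _ (fun=> w r)).
  by rewrite sum_nat_const_nat mulSn addnK mulnC.
move=> m /andP[le_m lt_m]; congr w; nia.
Qed.

Lemma greedy_degSr w e r n : (r * e <= n <= r.+1 * e)%N ->
  greedy_deg w e r.+1 n = (w r * (r.+1 * e - n))%N.
Proof.
case/andP=> le_n n_le; rewrite /greedy_deg.
rewrite (@eq_big_nat _ _ _ _ _ _ (fun=> w r)).
  by rewrite sum_nat_const_nat mulnC.
move=> m /andP[le_m lt_m]; congr w; nia.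
Qed.

Lemma greedy_deg_ge w e r n : (r * e <= n)%N -> greedy_deg w e r n = 0%N.
Proof. by move=> le_n; rewrite /greedy_deg big_geq. Qed.

Lemma greedy_deg_cat w e r n s : (n + s <= r * e)%N ->
  greedy_deg w e r n =
    (\sum_(n <= m < n + s) w (m %/ e) + greedy_deg w e r (n + s))%N.
Proof. by move=> le_ns; rewrite /greedy_deg -big_cat_nat ?leq_addr. Qed.

(** Raising the index by [s] drops [s] roots, each of weight below [w r]. So trading copies of the
    next, heavier root for lighter ones lowers the degree. *)
Lemma greedy_deg_lipschitz w e r n s : {homo w : i j / (i < j)%N} ->
  (0 < s)%N -> (n + s <= r * e)%N ->
  (greedy_deg w e r n < greedy_deg w e r (n + s) + w r * s)%N.
Proof.
move=> w_mono s_gt0 le_ns; rewrite (greedy_deg_cat w le_ns) addnC ltn_add2l.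
have -> : (w r * s = \sum_(n <= m < n + s) w r)%N.
  by rewrite sum_nat_const_nat addKn mulnC.
apply: ltn_sum_nat; first by rewrite -[X in (X < _)%N]addn0 ltn_add2l.
move=> m /andP[le_m lt_m]; apply: w_mono; nia.
Qed.

(** Strict concavity: both differences are sums over windows of length [s], and moving the window by
    [t >= e] raises every [m %/ e], hence every weight. *)
Lemma greedy_deg_swap w e r n s t : {homo w : i j / (i < j)%N} ->
  (0 < s)%N -> (0 < e <= t)%N -> (n + s + t <= r * e)%N ->
  (greedy_deg w e r n + greedy_deg w e r (n + s + t) <
   greedy_deg w e r (n + s) + greedy_deg w e r (n + t))%N.
Proof.
move=> w_mono s_gt0 /andP[e_gt0 le_et] le_nst.
rewrite (@greedy_deg_cat w e r n s); last lia.
rewrite (@greedy_deg_cat w e r (n + t) s); last lia.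
suff lt_sum : (\sum_(n <= m < n + s) w (m %/ e) <
    \sum_(n + t <= m < n + t + s) w (m %/ e))%N.
  by rewrite (addnAC n t) in lt_sum *; lia.
rewrite (addnAC n t) big_addn addnK; apply: ltn_sum_nat; first lia.
move=> m _; apply: w_mono; nia.
Qed.

Section SpecialisedCoefficients.

Variables (p e : nat) (w : nat -> nat).
Hypotheses (p_pr : prime p) (e_gt0 : (0 < e)%N) (lt_ep : (e < p)%N).
Hypothesis w_mono : {homo w : i j / (i < j)%N}.

Lemma bin_Fp_neq0 l : (l <= e)%N -> 'C(e, l)%:R != 0 :> 'F_p.
Proof.
move=> le_le; rewrite -(dvdn_pcharf (pchar_Fp p_pr)).
suff: ~~ (p %| e`!)%N by rewrite -(bin_fact le_le); apply: contra => /dvdn_mulr ->.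
elim: e lt_ep => [|n IHn] lt_np; first by rewrite fact0 Euclid_dvd1.
by rewrite factS Euclid_dvdM // negb_or IHn ?(ltnW lt_np) // gtnNdvd.
Qed.

Lemma size_coef_XsubXn_exp n l : (l <= e)%N ->
  size ((('X - ('X^n : {poly 'F_p})%:P) ^+ e)`_l) = (n * (e - l)).+1.
Proof.
move=> le_le; rewrite -polyCN exprDn.
rewrite coef_sum (bigD1 (Ordinal (leq_ltn_trans (leq_subr l e) (ltnSn e)))) //=.
rewrite subKn // big1 ?addr0 => [|[i /= lt_i] /eqP ne_i].
  rewrite coefMn -rmorphXn /= coefMC coefXn eqxx mul1r exprNn -exprM.
  by rewrite -mulrnAr size_Msign -scaler_nat size_scale ?size_polyXn ?bin_sub ?bin_Fp_neq0.
rewrite coefMn -rmorphXn /= coefMC coefXn.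
case: eqP => [def_l|_]; last by rewrite mul0r mul0rn.
by case: ne_i; apply: val_inj => /=; rewrite def_l subKn.
Qed.

(** Induction on [r], splitting off the heaviest root: exactly one term of the convolution has top
    degree, so nothing cancels. *)
Lemma size_coef_greedy r n :
  size ((\prod_(j < r) ('X - ('X^(w j) : {poly 'F_p})%:P) ^+ e)`_n) =
  (if n <= r * e then (greedy_deg w e r n).+1 else 0)%N.
Proof.
elim: r n => [|r IHr] n.
  rewrite big_ord0 mul0n leqn0 coef1.
  by case: eqP => [->|_]; rewrite ?size_poly0 // greedy_deg_ge ?size_poly1.
rewrite big_ord_recr /= mulrC coefM.
set A := _ ^+ e; set B := \prod_(j < r) _.
have szA : size A = e.+1 by rewrite size_exp_XsubC.
case: leqP => [le_n|lt_n]; last first.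
  rewrite big1 ?size_poly0 // => -[l /= lt_l] _.
  have [lt_el|le_le] := ltnP e l; first by rewrite [A`__]nth_default ?mul0r // szA.
  suff /eqP->: B`_(n - l) == 0 by rewrite mulr0.
  by rewrite -size_poly_eq0 IHr leqNgt ifF //; nia.
(* The fewest ['X] that the factor of the heaviest root must supply, since the others give at most
   [r * e]; truncation to 0 is intended. *)
pose l0 := (n - r * e)%N.
have lt_l0 : (l0 < n.+1)%N by rewrite ltnS leq_subr.
have le_l0 : (l0 <= e)%N by rewrite leq_subLR -mulSnr.
have def_n : greedy_deg w e r.+1 n = (w r * (e - l0) + greedy_deg w e r (n - l0))%N.
  rewrite /l0; case: (leqP n (r * e)) => [le_nr|lt_nr].
    rewrite greedy_degSl // (eqP le_nr) !subn0 addnC //.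
  rewrite greedy_degSr; last lia.
  by rewrite greedy_deg_ge; [rewrite addn0; congr muln; lia | lia].
have neA l : (l <= e)%N -> A`_l != 0.
  by move=> le_le; rewrite -size_poly_gt0 size_coef_XsubXn_exp.
have sz_main : size (A`_l0 * B`_(n - l0)) = (greedy_deg w e r.+1 n).+1.
  have szB : size B`_(n - l0) = (greedy_deg w e r (n - l0)).+1.
    by rewrite IHr ifT //; lia.
  rewrite size_mul ?neA //; last by rewrite -size_poly_gt0 szB.
  by rewrite szB size_coef_XsubXn_exp // def_n addnS.
rewrite (bigD1 (Ordinal lt_l0)) //= size_polyDl ?sz_main //.
rewrite ltnS; apply: leq_trans (size_sum _ _ _) _; apply/bigmax_leqP.
move=> [l /= lt_l] ne_l0; have {}ne_l0 : l != l0 by [].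
have [lt_el|le_le] := ltnP e l.
  by rewrite [A`__]nth_default ?mul0r ?size_poly0 // szA.
have [le_nl|lt_nl] := leqP (n - l)%N (r * e)%N; last first.
  suff /eqP->: B`_(n - l) == 0 by rewrite mulr0 size_poly0.
  by rewrite -size_poly_eq0 IHr leqNgt lt_nl.
apply: leq_trans (size_polyMleq _ _) _; rewrite size_coef_XsubXn_exp // IHr le_nl.
have lt_l0l : (l0 < l)%N by lia.
have := @greedy_deg_lipschitz w e r (n - l) (l - l0) w_mono.
rewrite subn_gt0 lt_l0l => /(_ isT).
have -> : (n - l + (l - l0) = n - l0)%N by lia.
rewrite def_n; nia.
Qed.

End SpecialisedCoefficients.

(** * Determinants with a dominant antidiagonal *)

Lemma ord_mono_ge d (f : 'I_d -> 'I_d) :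
  (forall i j : 'I_d, (i < j)%N -> (f i < f j)%N) -> forall i : 'I_d, (i <= f i)%N.
Proof.
move=> f_mono [i]; elim: i => [//|i IHi] lt_i.
have lt_i' := ltnW lt_i.
apply: leq_ltn_trans (IHi lt_i') _; exact: f_mono.
Qed.

Lemma perm_mono_id d (s : 'S_d) :
  (forall i j : 'I_d, (i < j)%N -> (s i < s j)%N) -> s = 1%g.
Proof.
move=> s_mono; have sV_mono (i j : 'I_d) : (i < j)%N -> (s^-1%g i < s^-1%g j)%N.
  move=> lt_ij; rewrite ltnNge leq_eqVlt negb_or.
  apply/andP; split.
    by apply: contraTneq lt_ij => /val_inj/perm_inj->; rewrite ltnn.
  by apply: contraL lt_ij => /s_mono; rewrite !permKV -leqNgt => /ltnW.
apply/permP => i; rewrite perm1; apply/val_inj/anti_leq.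
by rewrite (ord_mono_ge s_mono) andbT -{2}(permK s i) (ord_mono_ge sV_mono).
Qed.

Definition rev_perm d : 'S_d := perm (@rev_ord_inj d).

(** Without an ascent [s] is decreasing, so its composite with the reversal is increasing and must
    be the identity. *)
Lemma perm_ascent d (s : 'S_d) : s != rev_perm d ->
  exists i j : 'I_d, (i < j)%N && (s i < s j)%N.
Proof.
move=> ne_s; have [/existsP[i /existsP[j asc]]|/existsPn no_ascent] :=
  boolP [exists i : 'I_d, exists j : 'I_d, (i < j)%N && (s i < s j)%N].
  by exists i, j.
case/eqP: ne_s.
have s_anti (i j : 'I_d) : (i < j)%N -> (s j < s i)%N.
  move=> lt_ij; have /existsPn/(_ j) := no_ascent i.
  rewrite lt_ij -leqNgt leq_eqVlt => /orP[|//].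
  by move=> /eqP/val_inj/perm_inj eq_ij; rewrite eq_ij ltnn in lt_ij.
rewrite -[RHS]mul1g -(@perm_mono_id _ (s * rev_perm d)%g).
  apply/permP => i; rewrite !permM !permE; apply: val_inj => /=.
  by have := ltn_ord (s i); lia.
move=> i j /s_anti; rewrite !permM !permE /=.
have := ltn_ord (s i); lia.
Qed.

Section UniqueTopPermutation.

Variables (K : fieldType) (d : nat) (A : 'M[{poly K}]_d).
Variables (V : 'I_d -> 'I_d -> nat) (ok : 'I_d -> 'I_d -> bool).
Hypothesis size_A : forall i j, size (A i j) = (if ok i j then (V i j).+1 else 0)%N.
Hypothesis ok_rev : forall i, ok i (rev_ord i).
Hypothesis ok_swap : forall i i' j j' : 'I_d, (i < i')%N -> (j < j')%N ->
  ok i' j' -> ok i j' && ok i' j.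
Hypothesis V_swap : forall i i' j j' : 'I_d, (i < i')%N -> (j < j')%N ->
  ok i' j' -> (V i j + V i' j' < V i j' + V i' j)%N.

Let okp (s : 'S_d) := [forall i, ok i (s i)].
Let wt (s : 'S_d) := (\sum_i V i (s i))%N.

Lemma size_prod_perm (s : 'S_d) :
  size (\prod_i A i (s i)) = (if okp s then (wt s).+1 else 0)%N.
Proof.
case: ifPn => [/forallP ok_s|/forallPn[i nok_i]].
  have sz i : size (A i (s i)) = (V i (s i)).+1 by rewrite size_A ok_s.
  rewrite size_prod => [|i _]; last by rewrite -size_poly_gt0 sz.
  under eq_bigr do rewrite sz -addn1.
  by rewrite big_split /= sum1_card -addSn addnK.
suff A0 : A i (s i) = 0 by rewrite (bigD1 i) //= A0 mul0r size_poly0.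
by apply/eqP; rewrite -size_poly_eq0 size_A (negPf nok_i).
Qed.

(** Exchanging the two values at an ascent keeps the Leibniz term nonzero by [ok_swap] and raises
    its degree by [V_swap]. *)
Lemma swap_ascent s : okp s -> s != rev_perm d ->
  exists2 t, okp t & (wt s < wt t)%N.
Proof.
move=> /forallP ok_s /perm_ascent[i [j /andP[lt_ij lt_sij]]].
have ne_ij : i != j by rewrite -val_eqE neq_ltn lt_ij.
have := ok_s j; have /andP[ok1 ok2] := ok_swap lt_ij lt_sij (ok_s j).
move=> /(V_swap lt_ij lt_sij) lt_V; exists (tperm i j * s)%g.
  by apply/forallP => k; rewrite permM; case: tpermP => [->|->|_ _].
rewrite /wt (bigD1 i) //= (bigD1 j) //=; last by rewrite eq_sym.
rewrite [X in (_ < X)%N](bigD1 i) //= [X in (_ < _ + X)%N](bigD1 j) //=;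
  last by rewrite eq_sym.
rewrite !permM tpermL tpermR !addnA.
rewrite [X in (_ < _ + X)%N](eq_bigr (fun k => V k (s k))) ?ltn_add2r //.
by move=> k /andP[ne_ki ne_kj]; rewrite permM tpermD // eq_sym.
Qed.

(** A term of maximal degree has no ascent, so it is the antidiagonal one; being alone in that
    degree, it cannot be cancelled. *)
Lemma size_det_antidiag : size (\det A) = (\sum_i V i (rev_ord i)).+1.
Proof.
have ok_r : okp (rev_perm d) by apply/forallP => i; rewrite permE.
have wt_r : wt (rev_perm d) = (\sum_i V i (rev_ord i))%N.
  by apply: eq_bigr => i _; rewrite permE.
have [t ok_t t_max] := arg_maxnP wt ok_r.
have def_t : t = rev_perm d.
  apply/eqP; apply: contraT => /(swap_ascent ok_t)[u ok_u].
  by move=> lt_u; have := t_max u ok_u; rewrite /= leqNgt lt_u.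
rewrite {t ok_t}def_t in t_max.
rewrite /determinant (bigD1 (rev_perm d)) //= size_polyDl size_Msign size_prod_perm ok_r.
  by rewrite wt_r.
rewrite ltnS; apply: leq_trans (size_sum _ _ _) _; apply/bigmax_leqP => s ne_s.
rewrite size_Msign size_prod_perm; case: ifP => // ok_s.
have [u ok_u lt_u] := swap_ascent ok_s ne_s.
exact: leq_trans lt_u (t_max u ok_u).
Qed.
End UniqueTopPermutation.

(** * Specialisation of the determinant *)

Section Specialisation.

Variables (p r : nat) (S : comNzRingType) (iota : {rmorphism 'F_p -> S}).
Variable v : 'I_r -> S.

Lemma mmap_coef_fpoly e n :
  mmap iota v ((fpoly p r ^+ e)`_n) =
  (\prod_(k < r) ('X - (v k)%:P) ^+ e)`_n.
Proof.
suff defF : map_poly (mmap iota v) (fpoly p r ^+ e) =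
    \prod_(k < r) ('X - (v k)%:P) ^+ e by rewrite -coef_map /= defF.
rewrite rmorphXn /= rmorph_prod prodrXl; congr (_ ^+ e).
by apply: eq_bigr => k _; rewrite rmorphB /= map_polyX map_polyC /= mmapX mmap1U.
Qed.

Lemma mmap_det_Mmat e d :
  mmap iota v (\det (Mmat p r e d)) =
  \det (\matrix_(i < d, j < d)
    (\prod_(k < r) ('X - (v k)%:P) ^+ e)`_(i.+1 * p + j - d)%N).
Proof.
rewrite -det_map_mx; congr (\det _); apply/matrixP => i j.
by rewrite !mxE -mmap_coef_fpoly.
Qed.

Lemma mmap_delta :
  mmap iota v (delta p r) = \prod_(i < r) \prod_(j < r | (i < j)%N) (v i - v j).
Proof.
rewrite rmorph_prod; apply: eq_bigr => i _; rewrite rmorph_prod.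
by apply: eq_bigr => j _; rewrite rmorphB /= !mmapX !mmap1U.
Qed.

End Specialisation.

Lemma coef_fpoly_exp_gt p r e n : (r * e < n)%N -> (fpoly p r ^+ e)`_n = 0.
Proof.
move=> lt_n; apply: nth_default; apply: leq_trans lt_n.
rewrite (leq_trans (size_poly_exp_leq _ _)) // ltnS leq_mul2r.
by rewrite /fpoly size_prod_XsubC -[index_enum _]enumT size_enum_ord leqnn orbT.
Qed.

(** The indices in the last row are at least [d * p.-1], beyond the degree of [fpoly p r ^+ e]. *)
Lemma det_Mmat_eq0_gt p r e d : prime p -> (0 < d)%N ->
  (r * e < d * p.-1)%N -> \det (Mmat p r e d) = 0.
Proof.
move=> p_pr; case: d => // d _ lt_d; rewrite (expand_det_row _ ord_max) big1 // => j _.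
rewrite mxE coef_fpoly_exp_gt ?mul0r //=.
have := prime_gt0 p_pr; nia.
Qed.

Section MonomialSpecialisation.

Variables (p r e d : nat) (w : nat -> nat).
Hypotheses (p_pr : prime p) (w_mono : {homo w : i j / (i < j)%N}).

Local Notation spec := (mmap polyC (fun k : 'I_r => 'X^(w k) : {poly 'F_p})).

Lemma size_spec_det_Mmat : (0 < e < p)%N -> (d <= p)%N -> (d * p.-1 <= r * e)%N ->
  size (spec (\det (Mmat p r e d))) =
  (\sum_(i < d) greedy_deg w e r (i.+1 * p.-1)).+1.
Proof.
case/andP=> e_gt0 lt_ep le_dp le_d; rewrite mmap_det_Mmat.
pose n (i j : 'I_d) := (i.+1 * p + j - d)%N.
have n_le (i j : 'I_d) : (d <= i.+1 * p + j)%N by nia.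
rewrite (@size_det_antidiag _ _ _ (fun i j => greedy_deg w e r (n i j))
  (fun i j => n i j <= r * e)%N).
(* On the antidiagonal [j = d - 1 - i], so the index [i.+1 * p + j - d] is [i.+1 * p.-1]. *)
- congr _.+1; apply: eq_bigr => i _; congr greedy_deg.
  have := prime_gt0 p_pr; have := ltn_ord i; rewrite /n /=; nia.
- by move=> i j; rewrite mxE size_coef_greedy.
- move=> i; have := prime_gt0 p_pr; have := ltn_ord i; rewrite /n /=; nia.
- move=> i i' j j' lt_i lt_j; rewrite /n => le_n; apply/andP; split; nia.
move=> i i' j j' lt_i lt_j le_n.
(* Indices in two rows of one column differ by a multiple of [p], which exceeds [e]; this is the
   shift [t] in the concavity. *)
have := @greedy_deg_swap w e r (n i j) (j' - j) ((i' - i) * p) w_mono.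
have -> : (n i j + (j' - j) = n i j')%N by have := n_le i j; rewrite /n; lia.
have -> : (n i j' + (i' - i) * p = n i' j')%N.
  by have := n_le i j'; rewrite /n mulnBl; nia.
have -> : (n i j + (i' - i) * p = n i' j)%N.
  by have := n_le i j; rewrite /n mulnBl; nia.
apply; [lia | nia | by []].
Qed.

Lemma size_spec_delta_exp g : spec (delta p r ^+ g) != 0 /\
  size (spec (delta p r ^+ g)) =
  (g * \sum_(i < r) \sum_(j < r | (i < j)%N) w j).+1.
Proof.
have szB (i j : 'I_r) : (i < j)%N -> size ('X^(w i) - 'X^(w j) : {poly 'F_p}) = (w j).+1.
  by move=> /w_mono lt_w; rewrite addrC size_polyDl size_polyN !size_polyXn.
have neB (i j : 'I_r) : (i < j)%N -> 'X^(w i) - 'X^(w j) != 0 :> {poly 'F_p}.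
  by move=> /szB sz; rewrite -size_poly_gt0 sz.
have neD : spec (delta p r) != 0.
  rewrite mmap_delta; apply/prodf_neq0 => i _; apply/prodf_neq0 => j; exact: neB.
have neDg : spec (delta p r ^+ g) != 0 by rewrite rmorphXn expf_neq0.
split=> //; apply/eqP; rewrite -(prednK (_ : 0 < size _)%N) ?size_poly_gt0 // eqSS.
rewrite rmorphXn size_exp mulnC eqn_mul2l; apply/orP; right; apply/eqP.
suff -> : size (spec (delta p r)) = (\sum_(i < r) \sum_(j < r | (i < j)%N) w j).+1 by [].
rewrite mmap_delta.
have szP (P : pred 'I_r) (F : 'I_r -> {poly 'F_p}) (E : 'I_r -> nat) :
    (forall i, P i -> size (F i) = (E i).+1) ->
  size (\prod_(i | P i) F i) = (\sum_(i | P i) E i).+1.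
  move=> szF; rewrite size_prod => [|i /szF sz]; last by rewrite -size_poly_gt0 sz.
  rewrite (eq_bigr (fun i => (E i + 1)%N)) => [|i /szF->]; last by rewrite addn1.
  by rewrite big_split /= sum1_card -addSn addnK.
by apply: (szP) => i _; apply: szP => j; apply: szB.
Qed.

End MonomialSpecialisation.

(** With the first variable at 0, [fpoly p r ^+ e] becomes divisible by ['X^e], while the first row
    only has indices below [p]. The other variables go to distinct powers, which keeps [delta]
    nonzero. *)
Lemma det_Mmat_exp_lt p r e d g (c : 'F_p) : prime p -> (2 <= r)%N -> (0 < d)%N ->
  c != 0 -> \det (Mmat p r e d) = c%:MP * delta p r ^+ g -> (e < p)%N.
Proof.
move=> p_pr r_ge2 d_gt0 c_neq0 defD; rewrite ltnNge; apply/negP => le_pe.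
case: r r_ge2 defD => // r _ /(congr1 (mmap polyC
  (fun k : 'I_r.+1 => if k == ord0 then 0 else 'X^k : {poly 'F_p}))).
rewrite mmap_det_Mmat rmorphM rmorphXn /= mmapC mmap_delta.
case: d d_gt0 => // d _; rewrite (expand_det_row _ ord0) big1 => [|j _].
  move/esym/eqP; rewrite mulf_eq0 polyC_eq0 (negPf c_neq0) /= => /eqP; apply/eqP.
  apply: expf_neq0; apply/prodf_neq0 => i _; apply/prodf_neq0 => j lt_ij.
  rewrite /=; have -> : j == ord0 = false by apply/negP => /eqP j0; rewrite j0 in lt_ij.
  case: (i == ord0); first by rewrite sub0r oppr_eq0 expf_neq0 ?polyX_eq0.
  by rewrite -size_poly_gt0 addrC size_polyDl size_polyN !size_polyXn.
rewrite mxE big_ord_recl /= subr0 coefXnM ifT ?mul0r //.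
by have := ltn_ord j; have := prime_gt0 p_pr; rewrite /= mul1n; lia.
Qed.

(** * The degree identities *)

(** This is [greedy_deg] for the weight that is 1 on the first [m] roots and 0 on the others. *)
Lemma sum_step_weight m e r n : (m <= r)%N -> (0 < e)%N ->
  (\sum_(n <= x < r * e) (x %/ e < m) = m * e - n)%N.
Proof.
move=> le_mr e_gt0.
have [lt_nm|le_mn] := ltnP n (m * e).
  rewrite (@big_cat_nat _ _ _ (m * e)%N) /= ?(ltnW lt_nm) ?leq_mul2r ?le_mr ?orbT //.
  rewrite (@eq_big_nat _ _ _ _ _ _ (fun=> 1%N)) => [|x /andP[_ lt_x]]; last first.
    by rewrite ltn_divLR // lt_x.
  rewrite sum_nat_const_nat muln1 [X in (_ + X)%N]big_nat_cond big1 ?addn0 // => x.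
  by case/andP=> /andP[le_x _] _; rewrite ltn_divLR // ltnNge le_x.
rewrite big_nat_cond big1; first by apply/esym/eqP.
move=> x /andP[/andP[le_x _] _].
by rewrite ltn_divLR // ltnNge (leq_trans le_mn le_x).
Qed.

Lemma sum_step_pairs m r : (m <= r)%N ->
  (\sum_(i < r) \sum_(j < r | i < j) (j < m) = 'C(m, 2))%N.
Proof.
move=> le_mr; rewrite (exchange_big_dep predT) //= -bin2_sum big_mkord.
rewrite (big_ord_widen r id le_mr) [RHS]big_mkcond /=; apply: eq_bigr => j _.
rewrite sum_nat_const; case: ifP => _; last by rewrite muln0.
rewrite muln1 -[RHS](card_ord j) -sum1_card -[RHS]sum1_card.
by rewrite [RHS](big_ord_widen r (fun=> 1%N)) // ltnW.
Qed.

Lemma bin2_mul2 m : ('C(m, 2) * 2 = m * m.-1)%N.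
Proof. by case: m => [//|m]; rewrite bin2 muln2 halfK oddM /= andNb subn0. Qed.

Lemma det_Mmat_exponents p r e d g (c : 'F_p) : prime p -> (2 <= r)%N ->
  (0 < e)%N -> (0 < d <= p)%N -> c != 0 ->
  \det (Mmat p r e d) = c%:MP * delta p r ^+ g ->
  [/\ (e < p)%N, (d * p.-1 <= r * e)%N &
      forall m, (m <= r)%N -> (\sum_(i < d) (m * e - i.+1 * p.-1) = g * 'C(m, 2))%N].
Proof.
move=> p_pr r_ge2 e_gt0 /andP[d_gt0 le_dp] c_neq0 defD.
have lt_ep := det_Mmat_exp_lt p_pr r_ge2 d_gt0 c_neq0 defD.
have le_d : (d * p.-1 <= r * e)%N.
  rewrite leqNgt; apply/negP => /(det_Mmat_eq0_gt p_pr d_gt0) D0.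
  have [+ _] := @size_spec_delta_exp p r id (fun i j => id) g.
  have/esym/eqP := defD; rewrite D0 mulf_eq0 mpolyC_eq0 (negPf c_neq0) /=.
  by move=> /eqP->; rewrite rmorph0 eqxx.
split=> // m le_mr.
have key w (w_mono : {homo w : i j / (i < j)%N}) :
    (\sum_(i < d) greedy_deg w e r (i.+1 * p.-1) =
     g * \sum_(i < r) \sum_(j < r | (i < j)%N) w j)%N.
  have [_ szR] := @size_spec_delta_exp p r w w_mono g.
  have := @size_spec_det_Mmat p r e d w p_pr w_mono.
  rewrite e_gt0 lt_ep defD rmorphM /= mmapC mul_polyC size_scale // szR.
  by move=> /(_ isT le_dp le_d) [].
(* The step weight is not strictly increasing, so it is added to [double], whose increments of 2
   absorb the drop by 1. Both sides of [key] are linear in the weight, and subtracting the identity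
   for [double] leaves that for the step. *)
have w0_mono : {homo double : i j / (i < j)%N} by move=> i j /=; lia.
have w1_mono : {homo (fun j => j.*2 + (j < m))%N : i j / (i < j)%N} by move=> i j /=; lia.
rewrite -(sum_step_pairs le_mr); apply: (@addnI (\sum_(i < d) greedy_deg double e r (i.+1 * p.-1))).
transitivity (g * \sum_(i < r) \sum_(j < r | (i < j)%N) (j.*2 + (j < m)))%N.
  rewrite -(key _ w1_mono) -big_split; apply: eq_bigr => i _.
  by rewrite /greedy_deg big_split /= sum_step_weight.
rewrite [in RHS]key // -mulnDr; congr muln; rewrite -big_split.
by apply: eq_bigr => i _; rewrite big_split.
Qed.

(** The terms with [i < c] form an arithmetic progression and the later ones are truncated to 0.
    Doubling and moving the negative part to the left keeps the formula within [nat]. *)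
Lemma sum_linear_trunc d c a q : (c <= d)%N -> (c * q <= a)%N ->
  (c = d \/ a <= c.+1 * q)%N ->
  ((\sum_(i < d) (a - i.+1 * q)) * 2 + q * (c * c.+1) = c * a * 2)%N.
Proof.
move=> le_cd le_a ge_a; rewrite -(big_mkord predT (fun i => a - i.+1 * q)%N).
rewrite (@big_cat_nat _ _ _ c) //=.
have -> : (\sum_(c <= i < d) (a - i.+1 * q) = 0)%N.
  rewrite big_nat_cond big1 // => i /andP[/andP[le_ci lt_id] _].
  by case: ge_a => [eq_cd|ge_a]; nia.
rewrite addn0; elim: c {le_cd ge_a} le_a => [|c IHc] le_a; first by rewrite big_geq ?muln0.
by rewrite big_nat_recr //=; nia.
Qed.

(* Here [q] is [p - 1] and [k] is [p - 1 - e]. *)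
Lemma exponent_identities_cases r d g k (q := (g + 2 * k)%N) (e := (g + k)%N) :
  (2 <= r)%N -> (0 < d)%N -> (0 < g)%N -> (d * q <= r * e)%N ->
  (forall m, (m <= r)%N -> (\sum_(i < d) (m * e - i.+1 * q) = g * 'C(m, 2))%N) ->
  [\/ k = 0%N /\ d = r, (r * k <= q)%N /\ r = d.+1 | (r * k = q)%N /\ r = d.+2].
Proof.
move=> r_ge2 d_gt0 g_gt0 le_dq T_eq.
have T m c : (m <= r)%N -> (c <= d)%N -> (c * q <= m * e)%N ->
    (c = d \/ m * e <= c.+1 * q)%N ->
    (g * (m * m.-1) + q * (c * c.+1) = c * (m * e) * 2)%N.
  move=> le_mr le_cd le_c ge_c.
  by rewrite -(sum_linear_trunc le_cd le_c ge_c) T_eq // -mulnA bin2_mul2.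
(* At [m = c + 2] the quadratic identity collapses to [c * k = g], that is, [(c + 2) * k = q]. *)
have T_diag c : (c.+2 <= r)%N -> (c <= d)%N -> (c * q <= c.+2 * e)%N ->
    (c = d \/ c.+2 * e <= c.+1 * q)%N -> (c * k = g)%N.
  move=> le_cr le_cd le_c ge_c; have := T _ _ le_cr le_cd le_c ge_c.
  by rewrite /q /e /=; lia.
have [le_rk|lt_rk] := leqP (r * k)%N q.
  have le_dr : (d <= r)%N by rewrite /q /e in le_dq; nia.
  have [lt_dr|ge_dr] := ltnP d.+1 r; last first.
    have [eq_dr|ne_dr] := eqVneq d r.
      by constructor 1; split=> //; rewrite /q /e eq_dr in le_dq; nia.
    by constructor 2; split=> //; lia.
  have dk : (d * k = g)%N by apply: T_diag => //; [rewrite /q /e in le_rk *; nia | left].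
  by constructor 3; rewrite /q in le_rk *; nia.
exfalso.
have ex_m : exists m, (q < m * k)%N by exists r.
(* For the least [m] with [q < m * k], the value [m * e] lies between [(m - 2) * q] and
   [(m - 1) * q], so [T_diag] applies with [c = m - 2] as long as [m - 2 <= d]. *)
case: (ex_minnP ex_m) => m lt_mk min_m {ex_m}.
have le_mr := min_m _ lt_rk.
have m_ge3 : (2 < m)%N by rewrite /q in lt_mk; nia.
have le_mk : (m.-1 * k <= q)%N by rewrite leqNgt; apply/negP => /min_m; lia.
case: m m_ge3 le_mr lt_mk le_mk {min_m} => [|[|m]] //= m_gt0 le_mr lt_mk le_mk.
have [le_md|lt_dm] := leqP m d.
  have mk : (m * k = g)%N by apply: T_diag => //; [|right]; rewrite /q /e in lt_mk le_mk *; nia.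
  by rewrite /q in lt_mk; nia.
have dk : (d * k = g)%N.
  apply: T_diag => //; [lia | | by left].
  by rewrite /q /e in lt_mk le_mk *; nia.
have def_m : m = d.+1 by rewrite /q in le_mk; nia.
(* Now [g = d * k] and [q = (d + 2) * k], and the identity at [m = d + 3] would say
   [(d + 2) ^ 2 = (d + 1) * (d + 3)]. *)
have := T d.+3 d; rewrite -{1}def_m le_mr leqnn => /(_ isT isT) /=.
rewrite /q /e => T3; have := T3 _ (or_introl erefl); nia.
Qed.

(** * Divisibility by powers of delta *)

(** The kernel of [phi] is the prime ideal generated by [rho] and [A] lies outside it, so factors
    [rho] can be pulled out of [Q] one at a time. *)
Lemma prime_exp_cancel (R S : idomainType) (phi : {rmorphism R -> S}) (rho : R) :
  rho != 0 -> phi rho = 0 -> (forall x, phi x = 0 -> exists y, x = rho * y) ->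
  forall g A Q Z, phi A != 0 -> A * Q = rho ^+ g * Z -> exists Q', Q = rho ^+ g * Q'.
Proof.
move=> rho_neq0 phi_rho ker_phi; elim=> [|g IHg] A Q Z phiA defAQ.
  by exists Q; rewrite expr0 mul1r.
have /ker_phi[Q1 defQ] : phi Q = 0.
  apply: (mulfI phiA); rewrite -rmorphM defAQ exprS !rmorphM phi_rho.
  by rewrite !mul0r mulr0.
have [Q2 defQ1] : exists Q2, Q1 = rho ^+ g * Q2.
  apply: (IHg A Q1 Z phiA); apply: (mulfI rho_neq0).
  by rewrite mulrCA -defQ defAQ exprS mulrA.
by exists Q2; rewrite defQ defQ1 exprS mulrA.
Qed.

Section Identify.

Variables (K : fieldType) (r : nat) (a b : 'I_r).

(** The kernel of this substitution is generated by ['X_a - 'X_b], which is therefore a prime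
    element. *)
Definition identify : {mpoly K[r]} -> {mpoly K[r]} :=
  mmap (@mpolyC r K) (fun k => 'X_(if k == b then a else k)).

HB.instance Definition _ := GRing.RMorphism.on identify.

Lemma identifyX k : identify 'X_k = 'X_(if k == b then a else k).
Proof. by rewrite /identify mmapX mmap1U. Qed.

(** Congruence with the image modulo ['X_a - 'X_b] is stable under sums and products, and holds for
    constants and variables. *)
Lemma identify_sub P : exists Q, P - identify P = ('X_a - 'X_b) * Q.
Proof.
have idM x y : (exists Q, x - identify x = ('X_a - 'X_b) * Q) ->
    (exists Q, y - identify y = ('X_a - 'X_b) * Q) ->
    exists Q, x * y - identify (x * y) = ('X_a - 'X_b) * Q.
  move=> [Q1 def1] [Q2 def2]; exists (Q1 * y + identify x * Q2).
  rewrite rmorphM mulrDr mulrA -def1 mulrCA -def2; ring.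
have id1 : exists Q, 1 - identify 1 = ('X_a - 'X_b) * Q.
  by exists 0; rewrite rmorph1 subrr mulr0.
have idX k : exists Q, 'X_k - identify 'X_k = ('X_a - 'X_b) * Q.
  rewrite identifyX; case: eqP => [->|_]; last by exists 0; rewrite subrr mulr0.
  by exists (-1); rewrite mulrN1 opprB.
elim/mpolyind: P => [|c m P _ _ [Q defQ]].
  by exists 0; rewrite rmorph0 subrr mulr0.
have [Q' defQ'] : exists Q, 'X_[m] - identify 'X_[m] = ('X_a - 'X_b) * Q.
  rewrite mpolyXE_id; elim/big_ind: _ => // i _.
  by elim: (m i) => [|n IHn]; rewrite ?expr0 ?exprS //; apply: idM.
have idC : identify c%:MP = c%:MP by rewrite /identify mmapC.
exists (c%:MP * Q' + Q); rewrite rmorphD -mul_mpolyC rmorphM /= idC.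
rewrite mulrDr mulrCA -defQ' -defQ; ring.
Qed.

Lemma identify_eq0 P : identify P = 0 -> exists Q, P = ('X_a - 'X_b) * Q.
Proof. by have [Q] := identify_sub P => + P0; rewrite P0 subr0 => ->; exists Q. Qed.

Lemma mpolyX_sub_neq0 (i j : 'I_r) : i != j -> 'X_i - 'X_j != 0 :> {mpoly K[r]}.
Proof.
move=> ne_ij; rewrite subr_eq0; apply/eqP => /(congr1 (mcoeff U_(i))).
rewrite !mcoeffX eqxx; case: eqP => [/(congr1 (fun m : 'X_{1..r} => m i))|_ /eqP].
  by rewrite !mnm1E eqxx eq_sym (negPf ne_ij).
by rewrite oner_eq0.
Qed.

Lemma identify_sub_neq0 (i j : 'I_r) : (a < b)%N -> (i < j)%N ->
  (i, j) != (a, b) -> identify ('X_i - 'X_j) != 0.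
Proof.
move=> lt_ab lt_ij; rewrite xpair_eqE => ne_ij.
rewrite rmorphB /= !identifyX mpolyX_sub_neq0 //; apply: contra ne_ij.
case: (i =P b) => [i_b|_]; case: (j =P b) => [j_b|_] //.
- by rewrite i_b j_b ltnn in lt_ij.
- by move=> /eqP def_j; rewrite i_b -def_j ltnNge (ltnW lt_ab) in lt_ij.
- by rewrite andbT.
by move=> /eqP eq_ij; rewrite eq_ij ltnn in lt_ij.
Qed.

End Identify.

Lemma delta_pairs p r :
  delta p r = \prod_(u : 'I_r * 'I_r | (u.1 < u.2)%N) ('X_u.1 - 'X_u.2).
Proof. by rewrite /delta pair_big_dep. Qed.

Lemma delta_neq0 p r : delta p r != 0.
Proof.
rewrite delta_pairs; apply/prodf_neq0 => -[i j] /= lt_ij.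
by rewrite mpolyX_sub_neq0 // -val_eqE neq_ltn lt_ij.
Qed.

(** Pairs are treated one by one: the factors already extracted stay nonzero after identifying the
    next [a] and [b], so [prime_exp_cancel] passes the power of ['X_a - 'X_b] on to the cofactor. *)
Lemma delta_exp_dvd p r g (D : {mpoly 'F_p[r]}) :
  (forall a b : 'I_r, (a < b)%N -> exists Z, D = ('X_a - 'X_b) ^+ g * Z) ->
  exists Q, D = delta p r ^+ g * Q.
Proof.
move=> dvdD; rewrite delta_pairs -prodrXl -big_filter.
have : all (fun u : 'I_r * 'I_r => u.1 < u.2)%N
    [seq u : 'I_r * 'I_r <- index_enum ('I_r * 'I_r)%type | (u.1 < u.2)%N].
  by apply/allP => u; rewrite mem_filter => /andP[].
have : uniq [seq u : 'I_r * 'I_r <- index_enum ('I_r * 'I_r)%type | (u.1 < u.2)%N].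
  by rewrite filter_uniq // index_enum_uniq.
elim: [seq _ <- _ | _] => [|[a b] s IHs] /=; first by exists D; rewrite big_nil mul1r.
case/andP=> nin_s /IHs{}IHs /andP[lt_ab all_s]; have [Q defD] := IHs all_s.
have [Z defZ] := dvdD a b lt_ab.
have [Q' defQ] : exists Q', Q = ('X_a - 'X_b) ^+ g * Q'.
  apply: (@prime_exp_cancel _ _ (identify a b) _ _ _ (@identify_eq0 _ _ a b) _
    (\prod_(u <- s) ('X_u.1 - 'X_u.2) ^+ g) _ Z).
  - by rewrite mpolyX_sub_neq0 // -val_eqE neq_ltn lt_ab.
  - rewrite rmorphB /= !identifyX eqxx; case: eqP => _; by rewrite subrr.
  - rewrite rmorph_prod prodf_seq_neq0; apply/allP => -[i j] s_ij /=.
    rewrite rmorphXn expf_neq0 // identify_sub_neq0 //.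
      by have := allP all_s _ s_ij.
    by apply: contraNneq nin_s => <-.
  by rewrite -defD defZ.
by exists Q'; rewrite big_cons defD defQ mulrCA mulrA.
Qed.

(** * Evaluating the Cartier operator at a root *)

Section CartierEvaluation.

Variables (R : comNzRingType) (p : nat).
Hypothesis pchar_R : p \in [pchar R].

Let p_gt0 : (0 < p)%N. Proof. exact: prime_gt0 (pcharf_prime pchar_R). Qed.

Definition cartier_eval d (a : R) (H : {poly R}) : R :=
  \sum_(i < d) a ^+ (p * i) * H`_(i.+1 * p).-1.

Lemma cartier_eval_sum d a (I : finType) (F : I -> {poly R}) :
  cartier_eval d a (\sum_i F i) = \sum_i cartier_eval d a (F i).
Proof.
rewrite exchange_big; apply: eq_bigr => i _.
by rewrite coef_sum mulr_sumr.
Qed.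

Lemma cartier_evalC d a c H : cartier_eval d a (c%:P * H) = c * cartier_eval d a H.
Proof. by rewrite mulr_sumr; apply: eq_bigr => i _; rewrite coefCM mulrCA. Qed.

Lemma polyXsubC_exp_pchar (a : R) : ('X - a%:P) ^+ p = 'X^p - (a ^+ p)%:P.
Proof.
have chP : p \in [pchar {poly R}] by exact: (rmorph_pchar (@polyC R)).
by rewrite -(pFrobenius_autE chP) pFrobenius_autB_comm ?pFrobenius_autE ?rmorphXn //; apply: mulrC.
Qed.

(* The bound on the size says that the first [d] coefficients of the image
   of [('X - a%:P) ^+ p * K] under the Cartier operator are all of them. *)
Lemma cartier_eval_vanish d a (K : {poly R}) : (size K <= (d * p).-1)%N ->
  cartier_eval d a (('X - a%:P) ^+ p * K) = 0.
Proof.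
rewrite polyXsubC_exp_pchar => le_K.
(* Multiplication by ['X^p] shifts by one sampling step, so the terms telescope down to the last
   sampled coefficient of [K], which the size bound makes 0. *)
have telescope n : cartier_eval n.+1 a (('X^p - (a ^+ p)%:P) * K) =
    - (a ^+ (p * n.+1) * K`_(n.+1 * p).-1).
  elim: n => [|n IHn].
    rewrite /cartier_eval big_ord1 mulrBl coefB coefXnM coefCM muln0 muln1 mul1r.
    by rewrite mul1n ifT ?sub0r ?prednK.
  rewrite /cartier_eval big_ord_recr /= -/(cartier_eval n.+1 a _) IHn.
  rewrite mulrBl coefB coefXnM coefCM ifF; last by apply/negP; nia.
  have -> : ((n.+2 * p).-1 - p = (n.+1 * p).-1)%N by nia.
  rewrite mulrBr addKr mulrA -exprD; congr (- (_ ^+ _ * _)); nia.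
case: d le_K => [|d] le_K; first by rewrite /cartier_eval big_ord0.
by rewrite telescope nth_default ?mulr0 ?oppr0.
Qed.

(** Expanding ['X - b%:P] about [a] gives terms with [a - b] to the power [i] and ['X - a%:P] to the
    power [2 * e - i]. Those with [2 * e - i >= p] are killed; the others have [i >= g]. *)
Lemma cartier_eval_dvd d a b e g (G : {poly R}) : (g + p = e * 2 + 1)%N -> (g <= e)%N ->
  (size G + e * 2 <= (d.+1 * p).-1)%N ->
  exists Z, cartier_eval d a (('X - a%:P) ^+ e * ('X - b%:P) ^+ e * G) =
            (a - b) ^+ g * Z.
Proof.
move=> def_g le_ge le_G.
have -> : 'X - b%:P = ('X - a%:P) + (a - b)%:P by rewrite polyCB; ring.
rewrite (exprDn ('X - a%:P)) mulr_sumr mulr_suml cartier_eval_sum.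
have dvd (i : 'I_e.+1) : exists Z,
  cartier_eval d a (('X - a%:P) ^+ e * (('X - a%:P) ^+ (e - i) * (a - b)%:P ^+ i
     *+ 'C(e, i)) * G) = (a - b) ^+ g * Z.
  rewrite -mulr_natl -polyC_natr -rmorphXn.
  set c := 'C(e, i)%:R.
  have -> : ('X - a%:P) ^+ e * (c%:P * (('X - a%:P) ^+ (e - i) * ((a - b) ^+ i)%:P)) * G
      = (c * (a - b) ^+ i)%:P * (('X - a%:P) ^+ (e + (e - i)) * G).
    by rewrite exprD polyCM; ring.
  rewrite cartier_evalC; have [lt_m|le_m] := ltnP (e + (e - i)) p.
    have -> : nat_of_ord i = (g + (i - g))%N by have := ltn_ord i; lia.
    by rewrite exprD; eexists; rewrite mulrCA -!mulrA; reflexivity.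
  exists 0; rewrite -(subnKC le_m) exprD -mulrA cartier_eval_vanish ?mulr0 //.
  apply: leq_trans (size_polyMleq _ _) _; rewrite size_exp_XsubC; nia.
elim/big_ind: _ => [|x y [Zx ->] [Zy ->]|i _]; last exact: dvd.
  by exists 0; rewrite mulr0.
by exists (Zx + Zy); rewrite mulrDr.
Qed.

End CartierEvaluation.

(** * Divisibility of the determinant by powers of root differences *)

Lemma monic_fpoly p r : fpoly p r \is monic.
Proof. by apply: monic_prod => i _; exact: monicXsubC. Qed.

Lemma size_fpoly_exp p r e : size (fpoly p r ^+ e) = (r * e).+1.
Proof.
rewrite polySpred ?expf_neq0 ?monic_neq0 ?monic_fpoly // size_exp /fpoly size_prod_XsubC.
by rewrite -[index_enum _]enumT size_enum_ord mulnC.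
Qed.

Lemma size_XsubC_expM (R : idomainType) e (a b : R) (G : {poly R}) : G \is monic ->
  size (('X - a%:P) ^+ e * ('X - b%:P) ^+ e * G) = (e * 2 + size G)%N.
Proof.
move=> mG; have mX (c : R) : ('X - c%:P) ^+ e \is monic by exact/monic_exp/monicXsubC.
have mXX : ('X - a%:P) ^+ e * ('X - b%:P) ^+ e \is monic by rewrite monicMl.
rewrite (size_monicM mXX (monic_neq0 mG)).
rewrite (size_monicM (mX a) (monic_neq0 (mX b))) !size_exp_XsubC.
by rewrite addnS /= addnn muln2.
Qed.

Lemma det_Mmat_dvd p r e d g (a b : 'I_r) : prime p -> (a < b)%N ->
  (g + p = e * 2 + 1)%N -> (g <= e)%N -> (0 < d <= p)%N ->
  (r * e + d < d.+1 * p)%N ->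
  exists Z, \det (Mmat p r e d) = ('X_a - 'X_b) ^+ g * Z.
Proof.
move=> p_pr lt_ab def_g le_ge /andP[d_gt0 le_dp] lt_red.
have chR : p \in [pchar {mpoly 'F_p[r]}].
  exact: (rmorph_pchar (@mpolyC r 'F_p)) (pchar_Fp p_pr).
have ne_ba : b != a by rewrite -val_eqE neq_ltn lt_ab orbT.
pose G := (\prod_(k < r | (k != a) && (k != b)) ('X - ('X_k : {mpoly 'F_p[r]})%:P)) ^+ e.
have defF : fpoly p r ^+ e = ('X - ('X_a)%:P) ^+ e * ('X - ('X_b)%:P) ^+ e * G.
  by rewrite /G -!exprMn -mulrA /fpoly (bigD1 a) //= (bigD1 b).
have szG : (size G + e * 2 = (r * e).+1)%N.
  have mG : G \is monic by apply/monic_exp/monic_prod => k _; exact: monicXsubC.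
  by rewrite -(size_fpoly_exp p) defF size_XsubC_expM // addnC.
pose u : 'rV[{mpoly 'F_p[r]}]_d := \row_i 'X_a ^+ (p * i).
have [z def_z] : exists z, u *m Mmat p r e d = ('X_a - 'X_b) ^+ g *: z.
  suff dvd_j j : exists Z, (u *m Mmat p r e d) 0 j = ('X_a - 'X_b) ^+ g * Z.
    have [z zP] := fin_all_exists dvd_j.
    by exists (\row_j z j); apply/rowP => j; rewrite zP !mxE.
  (* Column [j] samples ['X^(d.-1 - j) * fpoly p r ^+ e] at the indices [i.+1 * p - 1]; by [lt_red]
     its degree is below the next such index, [d.+1 * p - 1]. *)
  have -> : (u *m Mmat p r e d) 0 j =
      cartier_eval p d 'X_a ('X^(d.-1 - j) * fpoly p r ^+ e).
    rewrite mxE; apply: eq_bigr => i _; rewrite !mxE coefXnM; congr (_ * _).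
    have lt_j := ltn_ord j; rewrite ifF; last by apply/negP; nia.
    congr (_`_ _); nia.
  rewrite defF mulrCA; apply: cartier_eval_dvd => //.
  apply: (@leq_trans ((d.-1 - j) + size G + e * 2)); last by nia.
  rewrite leq_add2r; apply: leq_trans (size_polyMleq _ _) _.
  by rewrite size_polyXn.
(* Multiplying by the adjugate turns the left side into the determinant times [u], and the first
   entry of [u] is 1. *)
have := congr1 (fun A => (A *m \adj (Mmat p r e d)) 0 (Ordinal d_gt0)) def_z.
rewrite /= -mulmxA mul_mx_adj mul_mx_scalar -scalemxAl [LHS]mxE [RHS]mxE.
have -> : u 0 (Ordinal d_gt0) = 1 by rewrite mxE /= muln0 expr0.
by rewrite mulr1 => ->; eexists.
Qed.

(** * Homogeneity *)

Section Homogeneity.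

Variables (K : fieldType) (r : nat).

Lemma dhomog_big_prod (I : finType) (P : pred I) (F : I -> {mpoly K[r]}) (E : I -> nat) :
  (forall i, P i -> F i \is (E i).-homog) ->
  \prod_(i | P i) F i \is (\sum_(i | P i) E i)%N.-homog.
Proof.
move=> homF; elim/big_ind2: _ => // [|x m y n]; [exact: dhomog1 | exact: dhomogM].
Qed.

(** Homogeneity of total degree [N] with the polynomial variable in degree 1. As [N - n] truncates
    to 0, vanishing beyond [N] is a separate clause; otherwise constants would be allowed there. *)
Definition bihomog (F : {poly {mpoly K[r]}}) (N : nat) : Prop :=
  forall n, F`_n \is (N - n).-homog /\ ((N < n)%N -> F`_n = 0).

Lemma bihomog1 : bihomog 1 0.
Proof.
move=> n; rewrite coef1 sub0n; case: n => [|n] /=; first by rewrite dhomog1.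
by rewrite dhomog0.
Qed.

Lemma bihomogM F G M N : bihomog F M -> bihomog G N -> bihomog (F * G) (M + N).
Proof.
move=> homF homG n; split=> [|lt_n]; last first.
  rewrite coefM big1 // => i _; have [le_iM|lt_Mi] := leqP i M.
    by rewrite (homG _).2 ?mulr0 //; lia.
  by rewrite (homF i).2 ?mul0r.
rewrite coefM; apply: rpred_sum => i _; have lt_i := ltn_ord i.
have [le_iM|lt_Mi] := leqP i M; last by rewrite (homF i).2 // mul0r dhomog0.
have [le_iN|lt_Ni] := leqP (n - i) N; last by rewrite (homG (n - i)%N).2 // mulr0 dhomog0.
have -> : (M + N - n = (M - i) + (N - (n - i)))%N by lia.
exact: dhomogM (homF i).1 (homG (n - i)%N).1.
Qed.

Lemma bihomogX F N e : bihomog F N -> bihomog (F ^+ e) (N * e).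
Proof.
move=> homF; elim: e => [|e IHe]; first by rewrite muln0; exact: bihomog1.
by rewrite exprS mulnS; exact: bihomogM.
Qed.

Lemma bihomogXsubX (i : 'I_r) : bihomog ('X - ('X_i)%:P) 1.
Proof.
move=> n; rewrite coefB coefX coefC; case: n => [|[|n]] /=.
- by rewrite sub0r dhomogN dhomogX /= mdeg1.
- by rewrite subr0 dhomog1.
by rewrite subr0 dhomog0.
Qed.

End Homogeneity.

Lemma bihomog_fpoly p r : bihomog (fpoly p r) r.
Proof.
suff : bihomog (fpoly p r) (\sum_(i < r) 1)%N by rewrite sum1_card card_ord.
rewrite /fpoly; elim/big_ind2: _ => [|F M G N|i _]; [exact: bihomog1 | exact: bihomogM |].
exact: bihomogXsubX.
Qed.

Lemma dhomog_delta p r : delta p r \is ('C(r, 2)).-homog.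
Proof.
have -> : ('C(r, 2) = \sum_(i < r) \sum_(j < r | (i < j)%N) 1)%N.
  rewrite -(sum_step_pairs (leqnn r)); apply: eq_bigr => i _.
  by apply: eq_bigr => j _; rewrite ltn_ord.
apply: dhomog_big_prod => i _; apply: dhomog_big_prod => j _.
by apply: rpredB; rewrite dhomogX /= mdeg1.
Qed.

(** The indices in a Leibniz term have a sum independent of the permutation, so every nonzero term
    has the degree read off the antidiagonal. *)
Lemma dhomog_det_Mmat p r e d : prime p -> (d <= p)%N -> (d * p.-1 <= r * e)%N ->
  \det (Mmat p r e d) \is (\sum_(i < d) (r * e - i.+1 * p.-1))%N.-homog.
Proof.
move=> p_pr le_dp le_d; have p_gt0 := prime_gt0 p_pr.
have homF := bihomogX e (bihomog_fpoly p r).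
pose n (s : 'S_d) (i : 'I_d) := (i.+1 * p + s i - d)%N.
have sum_n s : (\sum_i n s i = \sum_(i < d) i.+1 * p.-1)%N.
  have sum_s : (\sum_i (n s i + d) = \sum_(i < d) (i.+1 * p) + \sum_(i < d) i)%N.
    rewrite [X in (_ + X)%N](reindex_perm s) -big_split /=.
    by apply: eq_bigr => i _; rewrite subnK //; nia.
  have sum_q : (\sum_(i < d) (i.+1 * p.-1 + d) = \sum_(i < d) (i.+1 * p) + \sum_(i < d) i)%N.
    rewrite [X in (_ + X)%N](reindex_inj rev_ord_inj) -big_split /=.
    by apply: eq_bigr => i _; have := ltn_ord i; nia.
  by move: sum_s; rewrite -sum_q !big_split /= => /addIn.
rewrite /determinant; apply: rpred_sum => s _.
rewrite -signr_odd; suff : \prod_i Mmat p r e d i (s i) \is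
    (\sum_(i < d) (r * e - i.+1 * p.-1))%N.-homog.
  by case: (odd _) => hom; rewrite ?expr1 ?expr0 ?mulN1r ?mul1r ?rpredN.
have [/forallP le_n|/forallPn[i]] := boolP [forall i, n s i <= r * e]%N; last first.
  rewrite -ltnNge => lt_n; rewrite (bigD1 i) //= mxE (homF _).2 ?mul0r ?dhomog0 //.
have -> : (\sum_(i < d) (r * e - i.+1 * p.-1) = \sum_i (r * e - n s i))%N.
  apply: (@addIn (\sum_(i < d) i.+1 * p.-1)); rewrite -{2}(sum_n s) -!big_split /=.
  apply: eq_bigr => i _; rewrite !subnK //; have := ltn_ord i; nia.
by apply: dhomog_big_prod => i _; rewrite mxE; exact: (homF _).1.
Qed.

(** * The determinant as a power of [delta] *)

Lemma det_Mmat_delta p r d g k (e := (g + k)%N) : prime p -> p = (g + 2 * k).+1 ->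
  (2 <= r)%N -> (0 < g)%N -> (0 < d <= p)%N ->
  [\/ k = 0%N /\ d = r, (r * k <= g + 2 * k)%N /\ r = d.+1 | (r * k = g + 2 * k)%N /\ r = d.+2] ->
  exists2 c : 'F_p, c != 0 & \det (Mmat p r e d) = c%:MP * delta p r ^+ g.
Proof.
move=> p_pr def_p r_ge2 g_gt0 /andP[d_gt0 le_dp] cases.
have def_q : p.-1 = (g + 2 * k)%N by rewrite def_p.
have le_dq : (d * p.-1 <= r * e)%N.
  by rewrite def_q /e; case: cases => -[? ?]; subst; nia.
have D_neq0 : \det (Mmat p r e d) != 0.
  have e_bd : (0 < e < p)%N by rewrite /e; lia.
  have := @size_spec_det_Mmat p r e d id p_pr (fun i j => id) e_bd le_dp le_dq.
  by move=> sz; apply/eqP => D0; rewrite D0 rmorph0 size_poly0 in sz.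
have [Q defQ] : exists Q, \det (Mmat p r e d) = delta p r ^+ g * Q.
  apply: delta_exp_dvd => a b lt_ab; apply: det_Mmat_dvd => //; rewrite /e; try lia.
  (* In the third case [r * k = p.-1] gives [r * e = d.+1 * p.-1], so [r * e + d] is exactly
     [d.+1 * p - 1]. *)
  by rewrite def_p; case: cases => -[? ?]; subst; nia.
have homD := dhomog_det_Mmat p_pr le_dp le_dq.
have homd : delta p r ^+ g \is ('C(r, 2) * g).-homog by apply/dhomogMn/dhomog_delta.
have eq_deg : (\sum_(i < d) (r * e - i.+1 * p.-1) = 'C(r, 2) * g)%N.
  have bin_eq := bin2_mul2 r.
  have := @sum_linear_trunc d d (r * e) p.-1 (leqnn d) le_dq (or_introl erefl).
  by rewrite def_q /e; case: cases => -[? ?]; subst; nia.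
have dg_neq0 : delta p r ^+ g != 0 by rewrite expf_neq0 ?delta_neq0.
have Q_neq0 : Q != 0 by apply: contraNneq D_neq0 => Q0; rewrite defQ Q0 mulr0.
have szD := dhomog_uniq D_neq0 homD (dhomog_msize homD).
have szd := dhomog_uniq dg_neq0 homd (dhomog_msize homd).
have : msize Q == 1%N.
  have := msizeM dg_neq0 Q_neq0; rewrite -defQ => szM.
  have eq_sz : (msize (\det (Mmat p r e d))).-1 = (msize (delta p r ^+ g)).-1.
    exact: etrans (esym szD) (etrans eq_deg szd).
  move: Q_neq0 dg_neq0 D_neq0 eq_sz szM; rewrite -!msize_poly_eq0.
  move: (msize Q) (msize (delta p r ^+ g)) (msize (\det _)); lia.
case/msize_poly1P => c c_neq0 defc; exists c => //.
by rewrite defQ defc mulrC.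
Qed.

(** * The list in terms of [g] and [k], and the equivalence *)

Lemma inB_cases p r d g k : p = (g + 2 * k).+1 -> (2 <= r)%N -> (0 < g)%N -> (d <= p)%N ->
  inB p r (g + k) d <->
  [\/ k = 0%N /\ d = r, (r * k <= g + 2 * k)%N /\ r = d.+1 | (r * k = g + 2 * k)%N /\ r = d.+2].
Proof.
move=> -> r_ge2 g_gt0 le_dp; rewrite /inB /inBplus /inB0 /inBminus subn1 /=.
have -> : (g + 2 * k - (g + k) = k)%N by lia.
split=> [/or3P[]|[[k0 dr]|[le_rk dr]|[eq_rk dr]]].
- by case/and3P=> ? /eqP? /eqP?; constructor 1; lia.
- by case/and5P=> ? ? ? ? /eqP?; constructor 2; split=> //; lia.
- by case/and5P=> ? ? ? /eqP? /eqP?; constructor 3; split=> //; lia.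
- by apply/or3P; constructor 1; lia.
- by apply/or3P; constructor 2; apply/and5P; split=> //; lia.
by apply/or3P; constructor 3; apply/and5P; split=> //; lia.
Qed.

Lemma inB_parameters p r e d : prime p -> inB p r e d ->
  exists g k, [/\ p = (g + 2 * k).+1, e = (g + k)%N, (2 <= r)%N, (0 < g)%N & (0 < d <= p)%N].
Proof.
move=> /prime_gt1 p_gt1 B; exists (2 * e - (p - 1))%N, (p - 1 - e)%N.
case/or3P: B => [/and3P[? /eqP? /eqP?]|/and5P[? ? ? ? /eqP?]|/and5P[? ? ? /eqP? /eqP?]].
- by split; lia.
- by split; lia.
(* Here [r * k = p - 1 < 2 * e] excludes [r = 2], so [d = r - 2] is positive. *)
by split; nia.
Qed.

Local Close Scope ring_scope.

Theorem theorem3 (p : nat) :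
  prime p -> (p < 200000)%N ->
  forall r e d : nat, inA p r e d <-> inB p r e d.
Proof.
move=> p_pr _ r e d; split=> [|B]; last first.
  have [g [k [def_p def_e r_ge2 g_gt0 d_bd]]] := inB_parameters p_pr B.
  have /andP[d_gt0 le_dp] := d_bd; subst e.
  have /(inB_cases def_p r_ge2 g_gt0 le_dp) cases := B.
  have [c c_neq0 defD] := det_Mmat_delta p_pr def_p r_ge2 g_gt0 d_bd cases.
  by split=> //; [lia | exists c, g].
case=> r_ge2 e_gt0 d_bd [c [g [c_neq0 g_gt0 defD]]].
have [lt_ep le_dq T_eq] := det_Mmat_exponents p_pr r_ge2 e_gt0 d_bd c_neq0 defD.
have /andP[d_gt0 le_dp] := d_bd.
(* Since [e <= p.-1], only the first summand can be nonzero at [m = 2], so [g] is the truncated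
   [2 * e - p.-1]; as [g] is positive, the subtraction is exact. *)
have def_g : (2 * e = g + p.-1)%N.
  have T2 := T_eq 2 r_ge2; rewrite binn muln1 in T2.
  have [le_q|lt_q] := leqP p.-1 (2 * e).
    have := @sum_linear_trunc d 1 (2 * e) p.-1 d_gt0; rewrite T2; nia.
  have := @sum_linear_trunc d 0 (2 * e) p.-1 (leq0n d); rewrite T2; nia.
have [k def_e] : exists k, e = (g + k)%N by exists (e - g)%N; lia.
have def_q : p.-1 = (g + 2 * k)%N by lia.
have def_p : p = (g + 2 * k).+1 by lia.
subst e; apply/(inB_cases def_p) => //.
by rewrite def_q in le_dq T_eq; exact: exponent_identities_cases.
Qed.
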